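(* Let $\varphi=\frac{1+\sqrt5}{2}$ and $d=d_\varphi$. The map $$(\mathbf{N},|\cdot|)\longrightarrow(\mathcal{X},d),\qquad n\longmapsto\{F_n,F_{n+1}\},$$ is a $(1,1)$-quasi-isometric embedding, where $F_n$ denotes the $n$-th Fibonacci number.
   Context: $\mathbf{N}=\{1,2,3,\dots\}$, with the metric $|m-n|$. $\mathcal{X}=\{\{n_1,n_2\}\subset\mathbf{N}\mid \gcd(n_1,n_2)=1\}$ is the set of unordered pairs of coprime natural numbers, regarded as sets; $n_1=n_2=1$ is allowed, giving $\{1,1\}=\{1\}\in\mathcal{X}$. For $\mathbf{n}=\{n_1,n_2\}\in\mathcal{X}$ and $m\in\mathbf{N}$ let $$q_{\mathbf{n}}(m)=\min\{|x|+|y| \mid m=n_1x+n_2y,\ x,y\in\mathbf{Z}\},$$ and for $\mathbf{m},\mathbf{n}\in\mathcal{X}$ let $q_{\mathbf{n}}(\mathbf{m})=\max_{m\in\mathbf{m}}q_{\mathbf{n}}(m)$. For $a>1$, the metric $d_a$ on $\mathcal{X}$ is $$d_a(\mathbf{m},\mathbf{n})=\log_a\bigl(\max\{q_{\mathbf{n}}(\mathbf{m}),q_{\mathbf{m}}(\mathbf{n})\}\bigr).$$ Fibonacci numbers: $F_0=0$, $F_1=1$, $F_{n+2}=F_{n+1}+F_n$; consecutive Fibonacci numbers are coprime, so $\{F_n,F_{n+1}\}\in\mathcal{X}$. For $K\ge1$, $L\ge0$, a map $f\colon(X,d_X)\to(Y,d_Y)$ between metric spaces is a $(K,L)$-quasi-isometric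 embedding if for all $x_1,x_2\in X$, $\frac1K d_X(x_1,x_2)-L\le d_Y(f(x_1),f(x_2))\le K d_X(x_1,x_2)+L$. *)

(* Defs.v *)
From HB Require Import structures.
From mathcomp Require Import all_boot all_order all_algebra finmap.
From mathcomp Require Import all_classical all_reals all_analysis.
From mathcomp Require Import zify ring lra.

Set Implicit Arguments.
Unset Strict Implicit.
Unset Printing Implicit Defensive.

Import Order.TTheory GRing.Theory Num.Theory.

Local Open Scope fset_scope.
Local Open Scope ring_scope.

Definition quasi_isometric_embedding (R : realType) (X Y : metricType R)
    (K L : R) (f : X -> Y) : Prop :=
  [/\ 1 <= K, 0 <= L &
    forall x1 x2 : X,
      K^-1 * mdist x1 x2 - L <= mdist (f x1) (f x2) <= K * mdist x1 x2 + L].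

(* The parameter R is a phantom: it fixes the field in which the distances of
   the metric structure below take their values. *)
Definition pos_nat (R : realType) : Type := {n : nat | (0 < n)%N}.

HB.instance Definition _ (R : realType) := Choice.on (pos_nat R).

Section PositiveNaturals.
Variable R : realType.
Implicit Types m n p : pos_nat R.

Definition pos_nat_dist m n : R := `|(val m)%:R - (val n)%:R|.

Lemma pos_nat_distxx m : pos_nat_dist m m = 0.
Proof. by rewrite /pos_nat_dist subrr normr0. Qed.

Lemma pos_nat_dist_positivity m n : pos_nat_dist m n = 0 -> m = n.
Proof.
move/normr0_eq0/eqP; rewrite subr_eq0 eqr_nat => /eqP mn.
exact: val_inj.
Qed.

Lemma pos_nat_dist_sym m n : pos_nat_dist m n = pos_nat_dist n m.
Proof. exact: distrC. Qed.

Lemma pos_nat_dist_triangle n m p :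
  pos_nat_dist m p <= pos_nat_dist m n + pos_nat_dist n p.
Proof. exact: ler_distD. Qed.

HB.instance Definition _ := isMetric.Build R (pos_nat R)
  pos_nat_distxx pos_nat_dist_positivity pos_nat_dist_sym pos_nat_dist_triangle.

End PositiveNaturals.

Definition is_coprime_pair (A : {fset nat}) : Prop :=
  exists n1 n2 : nat,
    [/\ (0 < n1)%N, (0 < n2)%N, coprime n1 n2 & A = [fset n1; n2]].

Record coprime_pair : Type := CoprimePair {
  coprime_pair_set :> {fset nat};
  _ : `[< is_coprime_pair coprime_pair_set >] }.

HB.instance Definition _ := [isSub for coprime_pair_set].
HB.instance Definition _ := [Choice of coprime_pair by <:].

Lemma coprime_pairP (A : coprime_pair) : is_coprime_pair A.
Proof. by apply/asboolP; case: A. Qed.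

(* [representable A m k]: m = n1 x + n2 y with A = {n1, n2} and k = |x| + |y|.
   All presentations A = {n1, n2} are allowed, so that no order on the
   unordered pair A has to be chosen. *)
Definition representable (A : {fset nat}) (m k : nat) : Prop :=
  exists (n1 n2 : nat) (x y : int),
    [/\ A = [fset n1; n2], m%:Z = n1%:Z * x + n2%:Z * y
      & k = (`|x| + `|y|)%N].

Lemma fset2_inj (a b c d : nat) : [fset a; b] = [fset c; d] ->
  (a = c /\ b = d) \/ (a = d /\ b = c).
Proof.
move/fsetP => E.
have := E a; have := E b; have := E c; have := E d.
by rewrite !inE !eqxx !orbT /=; lia.
Qed.

Lemma representable_fset2 n1 n2 m k : representable [fset n1; n2] m k ->
  exists x y : int, m%:Z = n1%:Z * x + n2%:Z * y /\ k = (`|x| + `|y|)%N.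
Proof.
move=> [a [b [x [y [/fset2_inj[] [-> ->] -> ->]]]]]; first by exists x, y.
by exists y, x; split; [rewrite addrC | rewrite addnC].
Qed.

Lemma representable_ex (A : coprime_pair) (m : nat) :
  exists k, `[< representable A m k >].
Proof.
have [n1 [n2 [_ _ co EA]]] := coprime_pairP A.
have [u [v uv]] := Bezoutz n1%:Z n2%:Z.
have g1 : gcdz n1%:Z n2%:Z = 1 by move: co; rewrite /gcdz /= => /eqP ->.
exists (`|(m%:Z * u)%R| + `|(m%:Z * v)%R|)%N; apply/asboolP.
exists n1, n2, (m%:Z * u), (m%:Z * v); split => //.
by rewrite -[LHS]mulr1 -g1 -uv; ring.
Qed.

Definition qlen (A : coprime_pair) (m : nat) : nat :=
  ex_minn (representable_ex A m).

Definition qmax (A B : coprime_pair) : nat :=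
  \max_(m <- (B : {fset nat})) qlen A m.

Implicit Types A B C : coprime_pair.

Lemma qlenP A m : representable A m (qlen A m).
Proof. by rewrite /qlen; case: ex_minnP => k /asboolP. Qed.

Lemma qlen_le A m k : representable A m k -> (qlen A m <= k)%N.
Proof. by move=> H; rewrite /qlen; case: ex_minnP => j _; apply; apply/asboolP. Qed.

Lemma mem_coprime_pair_gt0 (A : coprime_pair) m :
  m \in (A : {fset nat}) -> (0 < m)%N.
Proof.
have [n1 [n2 [h1 h2 _ ->]]] := coprime_pairP A.
by rewrite !inE => /orP[] /eqP ->.
Qed.

Lemma qlen_gt0 A m : (0 < m)%N -> (0 < qlen A m)%N.
Proof.
move=> m0; have [n1 [n2 [x [y [_ E ->]]]]] := qlenP A m.
by rewrite lt0n addn_eq0 !absz_eq0; apply/negP => /andP[/eqP x0 /eqP y0];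
  move: E; rewrite x0 y0 !mulr0 addr0; lia.
Qed.

Lemma qlen_mem A m : m \in (A : {fset nat}) -> (qlen A m <= 1)%N.
Proof.
have [n1 [n2 [_ _ _ EA]]] := coprime_pairP A.
rewrite EA !inE => /orP[] /eqP ->; apply: qlen_le; rewrite EA.
  by exists n1, n2, 1, 0; split => //; rewrite mulr1 mulr0 addr0.
by exists n1, n2, 0, 1; split => //; rewrite mulr1 mulr0 add0r.
Qed.

Lemma mem_qlen (A : coprime_pair) m : (0 < m)%N -> (qlen A m <= 1)%N ->
  m \in (A : {fset nat}).
Proof.
move=> m0; have := qlenP A m.
move=> [n1 [n2 [x [y [-> E ->]]]]] le1.
have [x0|y0] : x = 0 \/ y = 0 by lia.
  move: E le1; rewrite x0 mulr0 add0r => E le1.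
  have [y1|[y1|y1]] : y = 0 \/ y = 1 \/ y = -1 by lia.
  - by move: E; rewrite y1; lia.
  - by move: E; rewrite y1 => E; rewrite !inE; lia.
  - by move: E; rewrite y1; lia.
move: E le1; rewrite y0 mulr0 addr0 => E le1.
have [y1|[y1|y1]] : x = 0 \/ x = 1 \/ x = -1 by lia.
- by move: E; rewrite y1; lia.
- by move: E; rewrite y1 => E; rewrite !inE; lia.
- by move: E; rewrite y1; lia.
Qed.

Lemma qlen_le_qmax A (B : coprime_pair) m : m \in (B : {fset nat}) ->
  (qlen A m <= qmax A B)%N.
Proof. by move=> mB; rewrite /qmax; exact: (@leq_bigmax_seq _ _ xpredT (qlen A) m mB isT). Qed.

Lemma qmax_leP A (B : coprime_pair) k :
  (forall m, m \in (B : {fset nat}) -> (qlen A m <= k)%N) -> (qmax A B <= k)%N.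
Proof. by move=> H; apply/bigmax_leqP_seq => m mB _; apply: H. Qed.

Lemma qmax_gt0 A B : (0 < qmax A B)%N.
Proof.
have [n1 [n2 [h1 _ _ E]]] := coprime_pairP B.
have n1B : n1 \in (B : {fset nat}) by rewrite E !inE eqxx.
exact: leq_trans (qlen_gt0 A h1) (qlen_le_qmax A n1B).
Qed.

Lemma qmaxxx A : qmax A A = 1%N.
Proof.
by apply/eqP; rewrite eqn_leq qmax_gt0 andbT; apply: qmax_leP; exact: qlen_mem.
Qed.

Lemma qmax_subset A B : (qmax A B <= 1)%N ->
  {subset (B : {fset nat}) <= (A : {fset nat})}.
Proof.
move=> le1 m mB; apply: mem_qlen; first exact: mem_coprime_pair_gt0 mB.
exact: leq_trans (qlen_le_qmax A mB) le1.
Qed.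

Lemma qmax_mul A B C : (qmax C A <= qmax B A * qmax C B)%N.
Proof.
apply: qmax_leP => m mA.
apply: leq_trans (leq_mul (qlen_le_qmax B mA) (leqnn _)).
have [b1 [b2 [x [y [EB Em ->]]]]] := qlenP B m.
have [c1 [c2 [_ _ _ EC]]] := coprime_pairP C.
have b1B : b1 \in (B : {fset nat}) by rewrite EB !inE eqxx.
have b2B : b2 \in (B : {fset nat}) by rewrite EB !inE eqxx orbT.
have := qlenP C b1; rewrite EC => /representable_fset2[u1 [v1 [E1 q1]]].
have := qlenP C b2; rewrite EC => /representable_fset2[u2 [v2 [E2 q2]]].
have := qlen_le_qmax C b1B; have := qlen_le_qmax C b2B; rewrite q1 q2 => l2 l1.
apply: (@leq_trans (`|(u1 * x + u2 * y)%R| + `|(v1 * x + v2 * y)%R|)%N).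
  apply: qlen_le; rewrite EC.
  exists c1, c2, (u1 * x + u2 * y), (v1 * x + v2 * y); split => //.
  by rewrite Em E1 E2; ring.
rewrite mulnDl; nia.
Qed.

Definition logb (R : realType) (a x : R) : R := ln x / ln a.

Section CoprimePairMetric.
Variables (R : realType) (a : R) (a_gt1 : 1 < a).

Definition coprime_pair_dist (A B : coprime_pair) : R :=
  logb a (maxn (qmax B A) (qmax A B))%:R.

Lemma coprime_pair_distxx A : coprime_pair_dist A A = 0.
Proof. by rewrite /coprime_pair_dist /logb qmaxxx maxnn ln1 mul0r. Qed.

Lemma coprime_pair_dist_positivity A B : coprime_pair_dist A B = 0 -> A = B.
Proof.
have a0 : ln a != 0 by rewrite gt_eqF // ln_gt0.
move/eqP; rewrite mulf_eq0 invr_eq0 (negPf a0) orbF ln_eq0; last first.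
  by rewrite ltr0n leq_max qmax_gt0.
rewrite pnatr_eq1 => /eqP E.
apply: val_inj; apply/fsetP => m; apply/idP/idP; apply: qmax_subset;
by rewrite -E ?leq_maxl ?leq_maxr.
Qed.

Lemma coprime_pair_dist_sym A B : coprime_pair_dist A B = coprime_pair_dist B A.
Proof. by rewrite /coprime_pair_dist maxnC. Qed.

Lemma coprime_pair_dist_triangle B A C :
  coprime_pair_dist A C <= coprime_pair_dist A B + coprime_pair_dist B C.
Proof.
have a0 : 0 < ln a by rewrite ln_gt0.
have p D E : (0 < maxn (qmax D E) (qmax E D))%N by rewrite leq_max qmax_gt0.
rewrite /coprime_pair_dist /logb -mulrDl ler_pM2r ?invr_gt0 //.
rewrite -lnM ?posrE ?ltr0n // -natrM ler_ln ?posrE ?ltr0n ?muln_gt0 ?p //.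
rewrite ler_nat geq_max; apply/andP; split.
  by apply: leq_trans (qmax_mul A B C) _; rewrite leq_mul ?leq_maxl.
by apply: leq_trans (qmax_mul C B A) _; rewrite mulnC leq_mul ?leq_maxr.
Qed.

(* A copy of coprime_pair, indexed by the base a, carrying the metric d_a. *)
Definition coprime_pair_space of 1 < a : Type := coprime_pair.

HB.instance Definition _ := Choice.on (coprime_pair_space a_gt1).
HB.instance Definition _ := isMetric.Build R (coprime_pair_space a_gt1)
  coprime_pair_distxx coprime_pair_dist_positivity coprime_pair_dist_sym
  coprime_pair_dist_triangle.

End CoprimePairMetric.

Fixpoint fib (n : nat) : nat :=
  match n with
  | 0 => 0
  | S n' => match n' with
            | 0 => 1
            | S n'' => fib n' + fib n''
            end
  end%N.

Lemma fibSS n : fib n.+2 = (fib n.+1 + fib n)%N.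
Proof. by []. Qed.

Lemma fib_gt0 n : (0 < n)%N -> (0 < fib n)%N.
Proof.
elim: n => [//|[//|n] IH _].
by rewrite fibSS addn_gt0 IH.
Qed.

Lemma coprime_fib n : coprime (fib n) (fib n.+1).
Proof.
elim: n => [//|n IH].
by rewrite fibSS /coprime gcdnDl gcdnC.
Qed.

Lemma fib_is_coprime_pair (R : realType) (n : pos_nat R) :
  `[< is_coprime_pair [fset fib (val n); fib (val n).+1] >].
Proof.
apply/asboolP; exists (fib (val n)), (fib (val n).+1); split => //.
- exact: fib_gt0 (valP n).
- exact: fib_gt0.
- exact: coprime_fib.
Qed.

Definition fib_pair (R : realType) (n : pos_nat R) : coprime_pair :=
  CoprimePair (fib_is_coprime_pair n).

Definition golden_ratio (R : realType) : R := (1 + Num.sqrt 5) / 2.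

Lemma golden_ratio_gt1 (R : realType) : 1 < golden_ratio R.
Proof.
have : 1 < Num.sqrt (5 : R) by rewrite -[ltLHS]sqrtr1 ltr_sqrt; lra.
rewrite /golden_ratio; lra.
Qed.

(* Main.v *)
Require Import Defs.
From mathcomp Require Import all_boot all_order all_algebra finmap.
From mathcomp Require Import all_classical all_reals all_analysis.
From mathcomp Require Import zify ring lra.

(** Put [k = |m - n|] and let [M] be the maximum of the four word lengths that
    define the distance between [{F_m, F_(m+1)}] and [{F_n, F_(n+1)}].
    The addition formula and d'Ocagne's identity write each of the four numbers
    in terms of the other pair with coefficients of total size at most
    [F_(k+2)], while [F_(n+k+1) >= F_(k+1) F_(n+1)] forces [M >= F_(k+1)].
    Since [phi^(k-1) <= F_(k+1)] and [F_(k+2) <= phi^(k+1)], the logarithm of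
    [M] to the base [phi] lies within [1] of [k]. *)

Import Order.TTheory GRing.Theory Num.Theory.

Local Open Scope fset_scope.
Local Open Scope ring_scope.

Lemma fib_leS n : (fib n <= fib n.+1)%N.
Proof. by case: n => [//|n]; rewrite fibSS leq_addr. Qed.

Lemma fib_add n k :
  fib (n + k.+1) = (fib k.+1 * fib n.+1 + fib k * fib n)%N.
Proof.
elim: k n => [|k IH] n; first by rewrite addn1 mul1n mul0n addn0.
by rewrite -addSnnS IH !fibSS; ring.
Qed.

(** d'Ocagne's identity, solved for the smaller index so that the coefficients on the pair at
    [n + k] can be read off. *)
Lemma fib_docagne n k :
  (fib n)%:Z = (-1) ^+ k * ((fib k.+1)%:Z * (fib (n + k))%:Z
                           - (fib k)%:Z * (fib (n + k).+1)%:Z).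
Proof.
elim: k => [|k ->]; first by rewrite addn0 expr0 mul1r mul0r subr0 mul1r.
by rewrite addnS !fibSS exprS !PoszD; ring.
Qed.

Section FibPairs.
Variable R : realType.
Implicit Types a b : pos_nat R.

Lemma qlen_fib_pair_le a (m k : nat) (x y : int) :
  m%:Z = (fib (val a))%:Z * x + (fib (val a).+1)%:Z * y ->
  (`|x| + `|y| <= k)%N -> (qlen (fib_pair a) m <= k)%N.
Proof.
move=> E; apply: leq_trans; apply: qlen_le.
by exists (fib (val a)), (fib (val a).+1), x, y.
Qed.

(** Both generators are at most [fib (val a).+1], so a word of length [l] represents at most
    [l * fib (val a).+1]. *)
Lemma leq_qlen_fib_pair a (m : nat) :
  (m <= qlen (fib_pair a) m * fib (val a).+1)%N.
Proof.
have /representable_fset2[x [y [E ->]]] := qlenP (fib_pair a) m.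
have := fib_leS (val a); nia.
Qed.

Lemma qmax_fib_pair_le a b (k : nat) :
    (qlen (fib_pair a) (fib (val b)) <= k)%N ->
    (qlen (fib_pair a) (fib (val b).+1) <= k)%N ->
  (qmax (fib_pair a) (fib_pair b) <= k)%N.
Proof. by move=> h0 h1; apply: qmax_leP => m; rewrite !inE => /orP[] /eqP ->. Qed.

Lemma qlen_fib_pair_forward a k :
  (qlen (fib_pair a) (fib (val a + k)) <= fib k.+1)%N.
Proof.
(* The addition formula covers only positive shifts; at shift 0 the number lies in the pair
   itself. *)
case: k => [|k]; first by rewrite addn0; apply: qlen_mem; rewrite !inE eqxx.
apply: (@qlen_fib_pair_le _ _ _ (fib k)%:Z (fib k.+1)%:Z).
  by rewrite fib_add PoszD !PoszM; ring.
by rewrite !absz_nat fibSS addnC.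
Qed.

Lemma qlen_fib_pair_backward a n k : val a = (n + k)%N ->
  (qlen (fib_pair a) (fib n) <= fib k.+2)%N.
Proof.
move=> ak.
(* The coefficients come from d'Ocagne's identity; their absolute values add up to
   [fib k.+1 + fib k]. *)
apply: (@qlen_fib_pair_le _ _ _ ((-1) ^+ k * (fib k.+1)%:Z)
                                (- ((-1) ^+ k * (fib k)%:Z))).
  by rewrite ak {1}(fib_docagne n k); ring.
by rewrite abszN !abszM !abszX !exp1n !mul1n !absz_nat fibSS.
Qed.

Lemma qmax_fib_pair_ub a b k : val b = (val a + k)%N ->
  (maxn (qmax (fib_pair b) (fib_pair a)) (qmax (fib_pair a) (fib_pair b))
     <= fib k.+2)%N.
Proof.
move=> abk; rewrite geq_max; apply/andP; split; apply: qmax_fib_pair_le.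
- exact: qlen_fib_pair_backward.
(* The upper member of the lower pair is only [k - 1] steps back, or in the pair when [k = 0]. *)
- case: k abk => [|k] abk.
    by apply: qlen_mem; rewrite !inE abk addn0 eqxx orbT.
  apply: leq_trans (fib_leS _).
  by apply: qlen_fib_pair_backward; rewrite abk addSnnS.
- by rewrite abk; apply: leq_trans (fib_leS _); apply: qlen_fib_pair_forward.
- by rewrite abk -addnS; apply: qlen_fib_pair_forward.
Qed.

Lemma qmax_fib_pair_lb a b k : val b = (val a + k)%N ->
  (fib k.+1
     <= maxn (qmax (fib_pair b) (fib_pair a)) (qmax (fib_pair a) (fib_pair b)))%N.
Proof.
move=> abk; rewrite leq_max; apply/orP; right.
have mb : fib (val b).+1 \in (fib_pair b : {fset nat}) by rewrite !inE eqxx orbT.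
apply: leq_trans (qlen_le_qmax (fib_pair a) mb).
have fa : (0 < fib (val a).+1)%N by exact: fib_gt0.
(* Cleared of the factor [fib (val a).+1], the bound is the addition formula with its second term
   dropped. *)
rewrite -(leq_pmul2r fa); apply: leq_trans (leq_qlen_fib_pair _ _).
by rewrite abk -addnS fib_add leq_addr.
Qed.

End FibPairs.

Section GoldenRatio.
Variable R : realType.
Let phi := golden_ratio R.

Lemma golden_ratio_sqr : phi ^+ 2 = phi + 1.
Proof.
have : Num.sqrt 5 ^+ 2 = 5 :> R by rewrite sqr_sqrtr // ler0n.
rewrite /phi /golden_ratio; nra.
Qed.

Let phi_gt1 : 1 < phi := golden_ratio_gt1 R.

Lemma golden_ratio_expSS n : phi ^+ n.+2 = phi ^+ n.+1 + phi ^+ n.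
Proof. by rewrite -addn2 exprD golden_ratio_sqr exprS; ring. Qed.

Lemma fib_le_golden_ratio n : (fib n.+1)%:R <= phi ^+ n.
Proof.
suff: (fib n.+1)%:R <= phi ^+ n /\ (fib n.+2)%:R <= phi ^+ n.+1 by case.
elim: n => [|n [h0 h1]]; first by rewrite expr0 expr1 lexx ltW.
by split=> //; rewrite fibSS natrD golden_ratio_expSS lerD.
Qed.

(** Multiplying by [phi] avoids the exponent [n - 1]. The recurrence has order two, so the induction
    carries two consecutive indices. *)
Lemma golden_ratio_le_fib n : phi ^+ n <= phi * (fib n.+1)%:R.
Proof.
suff: phi ^+ n <= phi * (fib n.+1)%:R /\ phi ^+ n.+1 <= phi * (fib n.+2)%:R
  by case.
elim: n => [|n [h0 h1]]; first by rewrite expr0 expr1 mulr1 lexx ltW.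
by split=> //; rewrite fibSS natrD golden_ratio_expSS mulrDr lerD.
Qed.

Lemma logb_golden_ratio_bounds (M k : nat) :
    (fib k.+1 <= M)%N -> (M <= fib k.+2)%N ->
  k%:R - 1 <= logb phi M%:R <= k%:R + 1.
Proof.
move=> lb ub.
have phi0 : 0 < phi by exact: lt_trans phi_gt1.
have lnphi : 0 < ln phi by rewrite ln_gt0.
have M0 : 0 < M%:R :> R by rewrite ltr0n (leq_trans _ lb) ?fib_gt0.
rewrite /logb ler_pdivlMr // ler_pdivrMr //; apply/andP; split.
  (* After exponentiation the lower bound reads [phi ^+ k <= phi * M]. *)
  rewrite mulrBl mul1r lerBlDl mulr_natl -lnXn // -lnM ?posrE //.
  rewrite ler_ln ?posrE ?exprn_gt0 ?mulr_gt0 //.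
  by apply: le_trans (golden_ratio_le_fib k) _; rewrite ler_pM2l // ler_nat.
rewrite natr1 mulr_natl -lnXn // ler_ln ?posrE ?exprn_gt0 //.
by apply: le_trans (fib_le_golden_ratio k.+1); rewrite ler_nat.
Qed.

Lemma coprime_pair_dist_fib_pair (m n : pos_nat R) :
  pos_nat_dist m n - 1 <= coprime_pair_dist phi (fib_pair m) (fib_pair n)
    <= pos_nat_dist m n + 1.
Proof.
(* Both distances are symmetric. *)
wlog mn : m n / (val m <= val n)%N.
  move=> H; case/orP: (leq_total (val m) (val n)) => /H //.
  by rewrite pos_nat_dist_sym coprime_pair_dist_sym.
have E : val n = (val m + (val n - val m))%N by rewrite subnKC.
have -> : pos_nat_dist m n = (val n - val m)%:R.
  by rewrite /pos_nat_dist distrC -natrB // normr_nat.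
by apply: logb_golden_ratio_bounds;
  [exact: qmax_fib_pair_lb | exact: qmax_fib_pair_ub].
Qed.

End GoldenRatio.

Theorem theorem1p1 (R : realType) :
  @quasi_isometric_embedding R
    (pos_nat R) (coprime_pair_space (golden_ratio_gt1 R)) 1 1
    (fun n : pos_nat R => fib_pair n).
Proof.
split=> // m n; rewrite invr1 !mul1r.
exact: coprime_pair_dist_fib_pair.
Qed.
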